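(* Let $M$ be a positive integer and let $S$ be a uniformly random binary string of length $M$. Let $\mathcal{O}_S$ be the String Guessing Oracle. Then for any bounded-error algorithm having access to $S$ only through $\mathcal{O}_S$, the expected number of queries required to identify $S$ with error probability at most $P_e$ is at least $[(1-P_e)M-1]/2$. Moreover, $\mathbb{P}[T=\Omega(M)]=1-P_e-o(1)$, where $T$ is the number of queries; that is, there is a universal constant $c>0$ such that $\mathbb{P}[T\ge cM]\ge 1-P_e-o(1)$ as $M\to\infty$.
   Context: String Guessing Oracle $\mathcal{O}_S$ for a hidden string $S\in\{0,1\}^M$: a query is a pair $(s,\sigma)$ consisting of a binary string $s$ of length $|s|\le M$ and an injective function $\sigma:\{1,\dots,|s|\}\to\{1,\dots,M\}$. The answer is the smallest $k$ such that $S_{\sigma(k)}\ne s_k$ if such a $k$ exists, and otherwise the symbol EQUAL. An algorithm queries the oracle adaptively (each query, the decision to stop and the output depend only on previous queries and answers and on private randomness independent of $S$), terminates almost surely, and outputs a string. Its error probability is at most $P_e$ if the output equals $S$ with probability at least $1-P_e$ over the random $S$ and the private randomness. *)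

(* Defs.v *)
From HB Require Import structures.
From mathcomp Require Import all_boot all_order all_algebra.
From mathcomp Require Import all_classical all_reals all_analysis.
Import Order.TTheory GRing.Theory Num.Theory.
Import numFieldNormedType.Exports.

Set Implicit Arguments.
Unset Strict Implicit.
Unset Printing Implicit Defensive.

Local Open Scope classical_set_scope.
Local Open Scope ring_scope.

(* A pair (s, sigma) with |s| <= M and sigma injective; s = empty string is
   allowed. Positions are numbered from 0. *)
Definition query (M : nat) : Type :=
  {m : 'I_M.+1 & (m.-tuple bool * {f : {ffun 'I_m -> 'I_M} | injectiveb f})%type}.

Section Oracle.
Variable M : nat.

Definition qlen (q : query M) : nat := tag q.

Definition qstr (q : query M) : 'I_(qlen q) -> bool := tnth (tagged q).1.

Definition qpos (q : query M) : 'I_(qlen q) -> 'I_M := val (tagged q).2.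

(* [None] is the symbol EQUAL; [Some k] carries the index of the first mismatch,
   counted from 1. *)
Definition answer : Type := option nat.

Definition first_mismatch (S : M.-tuple bool) (q : query M) (k : 'I_(qlen q)) :=
  (tnth S (qpos k) != qstr k) &&
  [forall j : 'I_(qlen q), (j < k)%N ==> (tnth S (qpos j) == qstr j)].

Definition oracle (S : M.-tuple bool) (q : query M) : answer :=
  omap (fun k : 'I_(qlen q) => k.+1) [pick k | first_mismatch S k].

Definition history : Type := seq (query M * answer).

(* Given the private randomness and the past, either ask a further query or stop
   with an output string. *)
Definition algorithm (W : Type) : Type := W -> history -> query M + seq bool.

Section Run.
Variables (W : Type) (A : algorithm W) (u : W) (S : M.-tuple bool).

(* The history after [n] queries, frozen once the algorithm has stopped. *)
Fixpoint transcript (n : nat) : history :=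
  if n is n'.+1 then
    let h := transcript n' in
    if A u h is inl q then rcons h (q, oracle S q) else h
  else [::].

Definition stops_with (n : nat) (y : seq bool) : Prop :=
  A u (transcript n) = inr y.

Definition halts : Prop := exists n y, stops_with n y.

Definition outputs (y : seq bool) : Prop := exists n, stops_with n y.

(* The infimum of the empty set is +oo: a run that never stops makes infinitely
   many queries. *)
Definition num_queries (R : realType) : \bar R :=
  ereal_inf [set (n%:R)%:E | n in [set n | exists y, stops_with n y]].

End Run.
End Oracle.

(* S is the hidden string and U the private randomness. The types of strings,
   queries and outputs are countable, so measurability into them is measurability
   of the fibres. *)
Record guesses_string (R : realType) (M : nat)
    (d : measure_display) (Omega : measurableType d) (P : probability Omega R)
    (d' : measure_display) (W : measurableType d')
    (S : Omega -> M.-tuple bool) (U : Omega -> W) (A : algorithm M W)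
    (Pe : R) : Prop := GuessesString {
  guess_S_meas : forall s, measurable (S @^-1` [set s]);
  guess_S_unif : forall s, P (S @^-1` [set s]) = ((2 ^+ M)^-1)%:E;
  guess_U_meas : measurable_fun setT U;
  guess_indep : forall s (B : set W), measurable B ->
    P (S @^-1` [set s] `&` U @^-1` B) =
      (P (S @^-1` [set s]) * P (U @^-1` B))%E;
  guess_A_meas : forall h a, measurable [set u | A u h = a];
  guess_halts : {ae P, forall w, halts A (U w) (S w)};
  guess_success : ((1 - Pe)%:E <= P [set w | outputs A (U w) (S w) (S w)])%E
}.

(* Main.v *)
Require Import Defs.
From mathcomp Require Import all_boot all_order all_algebra.
From mathcomp Require Import all_classical all_reals all_analysis.
From mathcomp Require Import ring lra zify.
Import Order.TTheory GRing.Theory Num.Theory.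
Import numFieldNormedType.Exports.

Local Open Scope classical_set_scope.
Local Open Scope ring_scope.

(* Fix the private randomness. The strings compatible with a history form a
   subcube, and one query reveals its bits one after the other, each new bit
   ending the query for half of the subcube; so a query reveals at most
   [1 + 1/2 + 1/4 + ... = 2] new bits on average, and the average of [(3/2)^N] over
   the number [N] of new bits is at most [3].  A guess made on a subcube of
   dimension [D] is right for at most one of its [2^D] strings.  Induction on the
   number of queries turns the first estimate into
   [M * #(right guesses) <= 2^M + 2 * #(queries)], summed over all strings, and the
   second into [#(right guesses within n queries) <= 3^n (4/3)^M].  Averaging
   over the randomness, which is independent of [S], gives the bound on the
   expectation and, with [n = M/4] and [3 < (4/3)^4], the error term [(8/9)^M]. *)

(** * Counting over subcubes of strings *)

Section Subcube.
Context {R : realFieldType} {M : nat}.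
Implicit Types (K : {set 'I_M}) (t : 'I_M -> bool) (S : M.-tuple bool).

(** [K] holds the revealed positions and [t] their bits; the values of [t] off [K] are irrelevant.
    The dimension is [#|~: K|]. *)
Definition subcube K t S : bool := [forall i in K, tnth S i == t i].

Definition upd t (p : 'I_M) (b : bool) : 'I_M -> bool :=
  fun i => if i == p then b else t i.

Lemma subcube_upd K t p b S : p \notin K ->
  subcube (p |: K)%SET (upd t p b) S = subcube K t S && (tnth S p == b).
Proof.
move=> pK; apply/forall_inP/andP => [H|[/forall_inP H Hp] i].
  split; last by have := H p (setU11 _ _); rewrite /upd eqxx.
  apply/forall_inP => i iK; have := H i (setU1r _ iK); rewrite /upd.
  by have [ip|//] := eqVneq i p; rewrite -ip iK in pK.
by rewrite /upd !inE; have [->|_ /= iK] := eqVneq i p; last exact: H.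
Qed.

Lemma sum_subcube_split K t p b (F : M.-tuple bool -> R) : p \notin K ->
  \sum_(S | subcube K t S) F S =
  \sum_(S | subcube (p |: K)%SET (upd t p b) S) F S +
  \sum_(S | subcube (p |: K)%SET (upd t p (~~ b)) S) F S.
Proof.
move=> pK; rewrite (bigID (fun S => tnth S p == b)) /=; congr (_ + _).
  by apply: eq_bigl => S; rewrite subcube_upd.
by apply: eq_bigl => S; rewrite subcube_upd //; case: (tnth S p); case: b.
Qed.

Lemma card_setCU1 {K} {p : 'I_M} : p \notin K ->
  #|~: K| = #|~: (p |: K)%SET|.+1.
Proof.
move=> pK; rewrite (cardsD1 p (~: K)%SET). rewrite finset.in_setC pK add1n; congr _.+1.
by apply: eq_card => i; rewrite !inE negb_or andbC.
Qed.

Lemma card_subcube K t : \sum_(S | subcube K t S) (1 : R) = 2 ^+ #|~: K|.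
Proof.
elim: {K}#|~: K| {-2}K (erefl #|~: K|) t => [|n IH] K HK t.
  have KT : K = [set: 'I_M]%SET.
    apply/setP => i; move/eqP: HK; rewrite cards_eq0 => /eqP/setP/(_ i).
    by rewrite !inE => /negbFE.
  rewrite HK (big_pred1 [tuple t i | i < M]) // => S; rewrite KT /=.
  apply/forall_inP/eqP => [H|-> i _]; last by rewrite tnth_mktuple.
  by apply: eq_from_tnth => i; rewrite tnth_mktuple; apply/eqP/H; rewrite inE.
have [E|[p]] := finset.set_0Vmem (~: K)%SET; first by rewrite E cards0 in HK.
rewrite finset.in_setC => pK; have := card_setCU1 pK; rewrite HK => -[/esym Hp].
by rewrite (sum_subcube_split _ _ p true) // !IH // Hp exprS mulrDl mul1r.
Qed.

Lemma first_mismatch_oracle S (q : query M) (k : 'I_(qlen q)) :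
  first_mismatch S k -> oracle S q = Some k.+1.
Proof.
move=> /andP[Sk /forallP Sj]; rewrite /oracle; case: pickP => [k' |/(_ k)] /=.
  move=> /andP[Sk' /forallP Sj']; congr (Some _.+1).
  case: (ltngtP k' k) => // kk.
    by have := Sj k'; rewrite kk /= (negPf Sk').
  by have := Sj' k; rewrite kk /= (negPf Sk).
by rewrite /first_mismatch Sk /=; move/forallP: (Sj) => ->.
Qed.

Lemma oracle_EQUAL S (q : query M) :
  (forall k : 'I_(qlen q), tnth S (qpos k) = qstr k) -> oracle S q = None.
Proof.
by move=> H; rewrite /oracle; case: pickP => //= k /andP[]; rewrite H eqxx.
Qed.

(* The bits of the query are revealed one at a time: a known bit costs nothing,
   a new bit either ends the query ([b]) or leaves it running ([c]), so that
   [c] satisfies the recursion below. *)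
Lemma sum_subcube_oracle (q : query M) (b c : nat -> R)
    (f : answer -> M.-tuple bool -> R) :
  (forall D, b D <= c D) -> (forall D, b D + c D <= c D.+1) ->
  (forall a K t, \sum_(S | subcube K t S) f a S <= b #|~: K|) ->
  forall K t, \sum_(S | subcube K t S) f (oracle S q) S <= c #|~: K|.
Proof.
move=> bc bcc Hf.
(* Generalised claim: on the whole subcube the first [k] characters of the query are correct, and
   [n] characters remain to be compared. *)
suff H n k K t : (n + k = qlen q)%N ->
    (forall S, subcube K t S ->
       forall j : 'I_(qlen q), (j < k)%N -> tnth S (qpos j) = qstr j) ->
    \sum_(S | subcube K t S) f (oracle S q) S <= c #|~: K|.
  by move=> K t; apply: (H (qlen q) 0%N); rewrite ?addn0.
elim: n k K t => [|n IH] k K t nk HS.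
  rewrite (eq_bigr (f None)); first exact: le_trans (Hf _ _ _) (bc _).
  by move=> S /HS HS'; rewrite oracle_EQUAL// => j; apply: HS'; rewrite -[k]add0n nk.
have kq : (k < qlen q)%N by rewrite -nk addSn ltnS leq_addl.
pose k' := Ordinal kq; pose p := qpos k'.
have nk' : (n + k.+1 = qlen q)%N by rewrite addnS -addSn.
have mism S : subcube K t S -> tnth S p != qstr k' -> oracle S q = Some k.+1.
  move=> SK Sp; apply: (@first_mismatch_oracle S q k'); rewrite /first_mismatch Sp /=.
  by apply/forallP => j; apply/implyP => jk; apply/eqP; apply: HS.
have next S : subcube K t S -> tnth S p = qstr k' ->
    forall j : 'I_(qlen q), (j < k.+1)%N -> tnth S (qpos j) = qstr j.
  move=> SK Sp j; rewrite ltnS leq_eqVlt => /orP[/eqP jk|]; last exact: HS.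
  by have -> : j = k' by exact: val_inj.
(* At a known position the comparison has one outcome on the whole subcube: either the query
   continues everywhere, or the answer is constant. *)
have [pK|pK] := boolP (p \in K).
  have Sp S : subcube K t S -> tnth S p = t p by move=> /forall_inP/(_ _ pK)/eqP.
  have [tp|tp] := eqVneq (t p) (qstr k').
    by apply: (IH k.+1) => // S SK; apply: next => //; rewrite Sp.
  rewrite (eq_bigr (f (Some k.+1))); first exact: le_trans (Hf _ _ _) (bc _).
  by move=> S SK; rewrite mism// Sp.
(* A new position halves the subcube: the mismatching half gets the constant answer [k.+1] and costs
   [b], the matching half continues and costs [c]. *)
rewrite (sum_subcube_split _ _ p (~~ qstr k')) // negbK (card_setCU1 pK).
apply: le_trans (bcc _); apply: lerD.
  rewrite (eq_bigr (f (Some k.+1))); first exact: Hf.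
  move=> S; rewrite subcube_upd // => /andP[SK /eqP Sp].
  by rewrite mism// Sp; case: (qstr k').
apply: (IH k.+1) => // S; rewrite subcube_upd // => /andP[SK /eqP Sp].
exact: next.
Qed.

Variable a : history M -> query M + seq bool.

(** [a] is the algorithm with its randomness fixed. Starting from an arbitrary history lets
    inductions peel off the first query. *)
Definition step S (h : history M) : history M :=
  if a h is inl q then rcons h (q, oracle S q) else h.

Definition asking h : bool := if a h is inl _ then true else false.

Definition guessed S h : bool := if a h is inr y then y == S else false.

Lemma sum_guessed_le1 K t h :
  \sum_(S | subcube K t S) (guessed S h)%:R <= (1 : R).
Proof.
rewrite /guessed; case: (a h) => [q|y]; first by rewrite big1.
case: (pickP (fun S : M.-tuple bool => y == S)) => [S0 /eqP ->|H].
  rewrite big_mkcond (bigD1 S0) //= eqxx big1 ?addr0; first by case: ifP.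
  by move=> S SS; rewrite eq_sym val_eqE (negPf SS) if_same.
by rewrite big1 // => S _; rewrite H.
Qed.

(** With [b D = 3 ^+ n * (4 / 3) ^+ D] and [c = 3 b], both [b D + c D] and [c D.+1] equal [4 b D];
    thus [4 / 3] is the base for which a query costs exactly a factor 3. *)
Lemma sum_guessed_le n K t h :
  \sum_(S | subcube K t S) (guessed S (iter n (step S) h))%:R
    <= (3 ^+ n * (4 / 3) ^+ #|~: K| : R).
Proof.
elim: n K t h => [|n IH] K t h.
  rewrite expr0 mul1r; apply: le_trans (sum_guessed_le1 _ _ _) _.
  by apply: exprn_ege1; lra.
under eq_bigr do rewrite iterSr.
have p0 D : (0 : R) <= 3 ^+ n * (4 / 3) ^+ D.
  by apply: mulr_ge0; apply: exprn_ge0; lra.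
case E : (a h) => [q|y]; rewrite /step E -/step.
  apply: (@sum_subcube_oracle q (fun D => 3 ^+ n * (4 / 3) ^+ D)
    (fun D => 3 ^+ n.+1 * (4 / 3) ^+ D)
    (fun x S => (guessed S (iter n (step S) (rcons h (q, x))))%:R)).
  - by move=> D; have := p0 D; rewrite exprS -mulrA; lra.
  - by move=> D; have := p0 D; rewrite !exprS; nra.
  - by move=> x K' t'; exact: IH.
(* A stopped run no longer changes, and the bound grows with [n]. *)
apply: le_trans (IH K t h) _.
by have := p0 #|~: K|; rewrite exprS -mulrA; lra.
Qed.

(** The right side is [M + 1] at [D = 0] and does not decrease: a step replaces [M - D + 1] by
    [2 (M - D)], no smaller while [D < M]. This is the case of no queries in
    [sum_guessed_asking_le]. *)
Lemma leq_expn2_mul D : (D <= M)%N -> (M < 2 ^ D * (M - D).+1)%N.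
Proof.
elim: D => [|D IH] DM; first by rewrite subn0 mul1n.
apply: leq_trans (IH (ltnW DM)) _; rewrite expnSr -mulnA leq_mul2l.
by apply/orP; right; rewrite -(subnSK DM) mul2n -addnn addSn addnS !ltnS leq_addr.
Qed.

(** The potential is one plus the number [M - #|~: K|] of known bits, summed over the subcube; a
    query raises its average by at most 2, which the term in [asking] pays for. *)
Lemma sum_guessed_asking_le n K t h :
  \sum_(S | subcube K t S)
    (M%:R * (guessed S (iter n (step S) h))%:R
      - 2 * \sum_(i < n) (asking (iter i (step S) h))%:R)
    <= (2 ^+ #|~: K| * (1 + M%:R - #|~: K|%:R) : R).
Proof.
elim: n K t h => [|n IH] K t h.
  under eq_bigr do rewrite big_ord0 mulr0 subr0.
  have DM : (#|~: K| <= M)%N by rewrite -[X in (_ <= X)%N]card_ord max_card.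
  rewrite -mulr_sumr /=; apply: (@le_trans _ _ (M%:R * 1)).
    by apply: ler_wpM2l => //; exact: sum_guessed_le1.
  have -> : 1 + M%:R - #|~: K|%:R = (M - #|~: K|).+1%:R :> R.
    by rewrite -natr1 natrB//; ring.
  by rewrite mulr1 -natrX -natrM ler_nat ltnW// leq_expn2_mul.
under eq_bigr do rewrite iterSr big_ord_recl /=.
have bump0 S (i : 'I_n) : step S (iter (0 + i) (step S) h) = iter i (step S) (step S h).
  by rewrite -iterS -iterSr.
under eq_bigr do under eq_bigr do rewrite bump0.
case E : (a h) => [q|y]; rewrite /asking E -/asking /step E -/step.
  (* [c D] exceeds [b D] by [2 * 2 ^+ D], exactly the charge for the first query over the subcube,
     and [b D + c D = c D.+1]. *)
  pose b (D : nat) : R := 2 ^+ D * (1 + M%:R - D%:R).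
  pose c (D : nat) : R := 2 ^+ D * (3 + M%:R - D%:R).
  pose f x S : R := M%:R * (guessed S (iter n (step S) (rcons h (q, x))))%:R
      - 2 * \sum_(i < n) (asking (iter i (step S) (rcons h (q, x))))%:R.
  have H : \sum_(S | subcube K t S) f (oracle S q) S <= c #|~: K|.
    apply: (@sum_subcube_oracle q b c).
    - by move=> D; rewrite ler_wpM2l ?exprn_ge0//; lra.
    - by move=> D; rewrite /b /c exprS -natr1; lra.
    - by move=> x K' t'; exact: IH.
  rewrite (eq_bigr (fun S => f (oracle S q) S - 2 * 1)); last first.
    by move=> S _; rewrite /f /=; ring.
  rewrite sumrB -mulr_sumr card_subcube; apply: le_trans (lerB H (lexx _)) _.
  by rewrite /c; lra.
by under eq_bigr do rewrite add0r; exact: IH.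
Qed.

End Subcube.

(** * Integrals of nonnegative functions and of finite sums of indicators *)

(** The integral of a nonnegative function is a supremum over the simple functions below it, hence
    monotone for arbitrary functions. It serves to bound the integral of [num_queries] from
    below. *)
Lemma ge0_le_integral_nonmeas {d} {T : measurableType d} {R : realType}
    (mu : {measure set T -> \bar R}) (f g : T -> \bar R) :
  (forall x, (0 <= f x)%E) -> (forall x, (f x <= g x)%E) ->
  (\int[mu]_x f x <= \int[mu]_x g x)%E.
Proof.
move=> f0 fg; rewrite !ge0_integralTE//; last by move=> x; exact: le_trans (fg x).
by apply: ereal_sup_le => _ [h /= hf <-]; exists h => // x; exact: le_trans (fg x).
Qed.

Lemma integral_sum_indic {d} {T : measurableType d} {R : realType}
    (P : probability T R) {J : Type} (s : seq J) (r : J -> R) (X : J -> set T) :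
  (forall j, measurable (X j)) ->
  (\int[P]_w (\sum_(j <- s) r j * \1_(X j) w)%:E
    = (\sum_(j <- s) r j * fine (P (X j)))%:E)%E.
Proof.
move=> mX.
have iX j : P.-integrable setT (fun w => (r j * \1_(X j) w)%:E).
  under eq_fun do rewrite EFinM.
  by apply: integrableZl => //; apply: integrable_indic.
under eq_integral do rewrite -sumEFin.
rewrite integral_sum// -sumEFin; apply: eq_bigr => j _.
under eq_integral do rewrite EFinM.
rewrite integralZl//; last by apply: integrable_indic.
by rewrite integral_indic// setIT EFinM fineK// fin_num_measure.
Qed.

Lemma sum_fine_probability_le {d} {T : measurableType d} {R : realType}
    (P : probability T R) {J : Type} (s : seq J) (r : J -> R) (X : J -> set T)
    (C : R) :
  (forall j, measurable (X j)) ->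
  (forall w, \sum_(j <- s) r j * \1_(X j) w <= C) ->
  \sum_(j <- s) r j * fine (P (X j)) <= C.
Proof.
move=> mX XC; rewrite -lee_fin -integral_sum_indic//.
have -> : C%:E = (\int[P]_w (cst C%:E w))%E.
  by rewrite integral_cst// [X in (_ * X)%E]probability_setT mule1.
apply: le_integral => //.
- under eq_fun do rewrite -sumEFin.
  apply: integrable_sum => // j _; under eq_fun do rewrite EFinM.
  by apply: integrableZl => //; apply: integrable_indic.
- exact: finite_measure_integrable_cst.
- by move=> w _; rewrite lee_fin.
Qed.

(** * Independence of string and randomness, and measurability of runs *)

Section Game.
Context {R : realType} {M : nat} {d : measure_display} {Omega : measurableType d}
  {P : probability Omega R} {d' : measure_display} {W : measurableType d'}
  {S : Omega -> M.-tuple bool} {U : Omega -> W} {A : algorithm M W} {Pe : R}.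
Hypothesis hyp : guesses_string P S U A Pe.

Lemma joint_bigcup (E : M.-tuple bool -> set W) :
  [set w | E (S w) (U w)] = \bigcup_s ((S @^-1` [set s]) `&` (U @^-1` E s)).
Proof.
apply/seteqP; split => [w Ew|w [s _ [/= <- //]]].
by exists (S w).
Qed.

Lemma measurable_randomness (B : set W) :
  measurable B -> measurable (U @^-1` B).
Proof.
by move=> mB; rewrite -[X in measurable X]setTI; exact: (guess_U_meas hyp).
Qed.

Lemma measurable_joint_fiber (E : M.-tuple bool -> set W) s :
  measurable (E s) -> measurable ((S @^-1` [set s]) `&` (U @^-1` E s)).
Proof.
move=> mE; apply: measurableI; first exact: guess_S_meas hyp s.
exact: measurable_randomness.
Qed.

Lemma measurable_joint (E : M.-tuple bool -> set W) :
  (forall s, measurable (E s)) -> measurable [set w | E (S w) (U w)].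
Proof.
move=> mE; rewrite joint_bigcup; apply: fin_bigcup_measurable => // s _.
exact: measurable_joint_fiber.
Qed.

(** The event splits over the finitely many values of [S], and on each piece independence and
    uniformity factor out [(2 ^+ M)^-1]. *)
Lemma probability_joint (E : M.-tuple bool -> set W) :
  (forall s, measurable (E s)) ->
  fine (P [set w | E (S w) (U w)]) =
  (2 ^+ M)^-1 * \sum_s fine (P (U @^-1` E s)).
Proof.
move=> mE; rewrite joint_bigcup measure_fin_bigcup; first last.
- by move=> s _; exact: measurable_joint_fiber.
- apply/trivIsetP => s t _ _ st; apply/seteqP; split => // w [[/= Ss _] [/= St _]].
  by rewrite -Ss St eqxx in st.
- exact: finite_finset.
have mU s : measurable (U @^-1` E s) by exact: measurable_randomness.
rewrite (fsbigE (index_enum _)) ?index_enum_uniq//; last first.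
  by move=> i _; rewrite mem_index_enum.
rewrite (eq_bigl xpredT); last by move=> i; rewrite in_setT.
rewrite -sum_fine; last first.
  by move=> s _; rewrite fin_num_measure//; exact: measurable_joint_fiber.
rewrite mulr_sumr; apply: eq_bigr => s _.
rewrite [X in fine X](guess_indep hyp s (mE s)) (guess_S_unif hyp) fineM//.
exact: fin_num_measure.
Qed.

(** This carries a count over all strings, valid for each fixed randomness, over to probabilities.
    The weights [r] may be negative, as they are for the queries. *)
Lemma sum_fine_joint_le {J : finType} (r : J -> R)
    (E : J -> M.-tuple bool -> set W) (C : R) :
  (forall j s, measurable (E j s)) ->
  (forall u, \sum_s \sum_j r j * \1_(E j s) u <= C) ->
  \sum_j r j * fine (P [set w | E j (S w) (U w)]) <= (2 ^+ M)^-1 * C.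
Proof.
move=> mE EC.
have mU j s : measurable (U @^-1` E j s) by exact: measurable_randomness.
under eq_bigr do rewrite probability_joint// mulrCA mulr_sumr.
rewrite -mulr_sumr ler_wpM2l ?invr_ge0 ?exprn_ge0//.
rewrite pair_big /=.
apply: (@sum_fine_probability_le _ _ _ P (J * M.-tuple bool)%type _ (fun x => r x.1)
  (fun x => U @^-1` E x.1 x.2)) => // w.
apply: le_trans (EC (U w)); rewrite exchange_big pair_big /=.
by rewrite le_eqVlt; apply/orP; left; apply/eqP/eq_bigr => x _; rewrite !indicE.
Qed.

(** Histories and choices are countable, so the event is a countable union over the previous history
    and the choice made there. *)
Lemma measurable_transcript s n (h : history M) :
  measurable [set u | transcript A u s n = h].
Proof.
elim: n h => [|n IH] h /=.
  have [->|h0] := eqVneq h [::]; last first.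
    rewrite (_ : [set _ | _] = set0)//; apply/seteqP; split => // u /= /esym/eqP.
    by rewrite (negPf h0).
  by rewrite (_ : [set _ | _] = setT)//; apply/seteqP; split.
rewrite (_ : [set _ | _] = \bigcup_(ha : history M * (query M + seq bool))
  (if (if ha.2 is inl q then rcons ha.1 (q, oracle s q) else ha.1) == h
   then [set u | transcript A u s n = ha.1] `&` [set u | A u ha.1 = ha.2]
   else set0)).
  apply: countable_bigcupT_measurable => [|[h' a] /=]; first exact: countableP.
  by case: ifP => // _; apply: measurableI => //; exact: guess_A_meas hyp _ _.
apply/seteqP; split => [u /= Hu|u [[h' a] _] /=].
  exists (transcript A u s n, A u (transcript A u s n)) => //=.
  by rewrite Hu eqxx.
by case: ifP => //= /eqP <- [-> ->].
Qed.

Lemma measurable_choice s n (B : set (query M + seq bool)) :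
  measurable [set u | B (A u (transcript A u s n))].
Proof.
rewrite (_ : [set _ | _] = \bigcup_(ha : history M * (query M + seq bool))
  (if `[< B ha.2 >]
   then [set u | transcript A u s n = ha.1] `&` [set u | A u ha.1 = ha.2]
   else set0)).
  apply: countable_bigcupT_measurable => [|[h' a] /=]; first exact: countableP.
  case: ifP => // _; apply: measurableI; first exact: measurable_transcript.
  exact: guess_A_meas hyp _ _.
apply/seteqP; split => [u /= Hu|u [[h' a] _] /=].
  exists (transcript A u s n, A u (transcript A u s n)) => //=.
  by case: asboolP.
by case: asboolP => //= Ba [-> ->].
Qed.

End Game.

Lemma indic_pred {T : Type} {R : pzRingType} (b : T -> bool) x :
  \1_[set y | b y] x = (b x)%:R :> R.
Proof.
rewrite indicE; case: (boolP (b x)) => bx; first by rewrite mem_set.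
by rewrite memNset//; exact/negP.
Qed.

(** * Stopping and query counts of a single run *)

Section Transcript.
Context {M : nat} {W : Type} (A : algorithm M W) (u : W).
Implicit Type s : M.-tuple bool.

Lemma transcript_iter s n : transcript A u s n = iter n (step (A u) s) [::].
Proof. by elim: n => //= n ->. Qed.

Lemma transcript_frozen s m n : (m <= n)%N ->
  ~~ asking (A u) (transcript A u s m) -> transcript A u s n = transcript A u s m.
Proof.
move=> /subnK <-; elim: (n - m)%N => //= k IH H.
by rewrite IH//; move: H; rewrite /asking; case: (A u _).
Qed.

Lemma stops_withW s m n y : (m <= n)%N ->
  stops_with A u s m y -> stops_with A u s n y.
Proof. by move=> mn E; rewrite /stops_with (transcript_frozen _ _ _ mn)// /asking E. Qed.

Lemma asking_ltn s m n y : stops_with A u s m y ->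
  asking (A u) (transcript A u s n) -> (n < m)%N.
Proof.
move=> E; rewrite ltnNge; apply: contraL => mn.
by rewrite (transcript_frozen _ _ _ mn) /asking E.
Qed.

Lemma guessedP s n :
  guessed (A u) s (transcript A u s n) <-> stops_with A u s n s.
Proof.
rewrite /guessed /stops_with; case: (A u _) => [q|y]; first by split.
by split => [/eqP ->|[->]].
Qed.

Lemma askingPn s n :
  ~~ asking (A u) (transcript A u s n) <-> exists y, stops_with A u s n y.
Proof.
rewrite /asking /stops_with; case: (A u _) => [q|y]; split => //; last by exists y.
by case.
Qed.

Lemma sum_asking_le_num_queries (R : realType) s n :
  ((\sum_(i < n) (asking (A u) (transcript A u s i))%:R)%:E
    <= num_queries A u s R)%E.
Proof.
(* It suffices to compare with each stopping time [m]; a run that never stops has none, and its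
   infimum is infinite. *)
apply: le_ereal_inf_tmp => _ [m [y Hm] <-]; rewrite lee_fin -natr_sum ler_nat.
apply: (@leq_trans (\sum_(i < n) (i < m)%N)).
  apply: leq_sum => i _; case E : (asking _ _) => //.
  by rewrite (asking_ltn _ _ _ _ Hm E).
suff -> : (\sum_(i < n) (i < m)%N = minn n m)%N by exact: geq_minr.
elim: n => [|n IH]; rewrite ?big_ord0 ?min0n// big_ord_recr /= IH.
by case: ltnP; lia.
Qed.

(** This rewrites a tail event of the query count through the measurable events of still asking at
    time [i]. *)
Lemma le_num_queriesP (R : realType) s (x : R) :
  (x%:E <= num_queries A u s R)%E <->
  (forall i, i%:R < x -> asking (A u) (transcript A u s i)).
Proof.
split => [xT i ix|H].
  apply: contraLR xT => /askingPn[y Hy]; rewrite -ltNge.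
  apply: (@le_lt_trans _ _ i%:R%:E); last by rewrite lte_fin.
  by apply: ereal_inf_lbound; exists i => //; exists y.
apply: le_ereal_inf_tmp => _ [m [y Hm] <-]; rewrite lee_fin leNgt.
by apply/negP => /H; rewrite /asking Hm.
Qed.

End Transcript.

(** * Expectation and tail of the number of queries *)

Section Bounds.
Context {R : realType} {M : nat} {d : measure_display} {Omega : measurableType d}
  {P : probability Omega R} {d' : measure_display} {W : measurableType d'}
  {S : Omega -> M.-tuple bool} {U : Omega -> W} {A : algorithm M W} {Pe : R}.
Hypothesis hyp : guesses_string P S U A Pe.

Definition guessed_by n : set Omega :=
  [set w | guessed (A (U w)) (S w) (transcript A (U w) (S w) n)].

(** This is the event that more than [n] queries are made, so partial sums of its probabilities
    bound the expectation from below. *)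
Definition asking_at n : set Omega :=
  [set w | asking (A (U w)) (transcript A (U w) (S w) n)].

Lemma measurable_guessed s n :
  measurable [set u | guessed (A u) s (transcript A u s n)].
Proof.
exact: (measurable_choice hyp s n
  [set a | is_true (if a is inr y then y == tval s else false)]).
Qed.

Lemma measurable_asking s n :
  measurable [set u | asking (A u) (transcript A u s n)].
Proof.
exact: (measurable_choice hyp s n
  [set a | is_true (if a is inl _ then true else false)]). Qed.

Lemma measurable_guessed_by n : measurable (guessed_by n).
Proof.
exact: (measurable_joint hyp (fun s => [set u | guessed (A u) s (transcript A u s n)])
  (fun s => measurable_guessed s n)).
Qed.

Lemma measurable_asking_at n : measurable (asking_at n).
Proof.
exact: (measurable_joint hyp (fun s => [set u | asking (A u) (transcript A u s n)])
  (fun s => measurable_asking s n)).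
Qed.

Lemma outputs_bigcup :
  [set w | outputs A (U w) (S w) (S w)] = \bigcup_n guessed_by n.
Proof.
by apply/seteqP; split => [w [n /guessedP]|w [n _ /guessedP]]; exists n.
Qed.

Lemma subcube0 (t : 'I_M -> bool) s : subcube finset.set0 t s = true.
Proof. by apply/forall_inP => i; rewrite finset.in_set0. Qed.

Lemma card_setC0 : #|(~: finset.set0 : {set 'I_M})%SET| = M.
Proof. by rewrite finset.setC0 cardsT card_ord. Qed.

Lemma guessed_by_le n :
  fine (P (guessed_by n)) <= 3 ^+ n * (2 / 3) ^+ M.
Proof.
have := @sum_fine_joint_le _ _ _ _ _ _ _ _ _ _ _ hyp 'I_1 (fun=> 1)
  (fun _ s => [set u | guessed (A u) s (transcript A u s n)])
  (3 ^+ n * (4 / 3) ^+ M) (fun _ s => measurable_guessed s n).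
rewrite big_ord1 mul1r => H; apply: (le_trans (H _)) => [u|].
  have := sum_guessed_le (R := R) (A u) n finset.set0 (fun=> true) [::].
  rewrite card_setC0; apply: le_trans.
  rewrite le_eqVlt; apply/orP; left; apply/eqP.
  apply: eq_big => [s|s _]; first by rewrite subcube0.
  by rewrite big_ord1 mul1r indic_pred -transcript_iter.
(* The average over strings contributes [2^-1] per bit, the count [4 / 3]. *)
have -> : (2 / 3 : R) = 2^-1 * (4 / 3) by field.
by rewrite [(2^-1 * _) ^+ M]exprMn exprVn mulrCA.
Qed.

Lemma guessed_by_asking_at_le n :
  M%:R * fine (P (guessed_by n)) - 2 * \sum_(i < n) fine (P (asking_at i)) <= 1.
Proof.
(* Index 0 carries the correct guess with weight [M], index [i.+1] the query at time [i] with weight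
   [- 2]. *)
have := @sum_fine_joint_le _ _ _ _ _ _ _ _ _ _ _ hyp 'I_n.+1
  (fun j => if j == 0%N :> nat then M%:R else - 2)
  (fun j s => if nat_of_ord j is i.+1
    then [set u | asking (A u) (transcript A u s i)]
    else [set u | guessed (A u) s (transcript A u s n)]) (2 ^+ M).
rewrite mulVf ?expf_neq0// big_ord_recl /= -mulr_sumr mulNr; apply.
  by case=> [[|j] /= _] s; [exact: measurable_guessed|exact: measurable_asking].
move=> u; have := sum_guessed_asking_le (R := R) (A u) n finset.set0 (fun=> true) [::].
rewrite card_setC0 addrK mulr1; apply: le_trans.
rewrite le_eqVlt; apply/orP; left; apply/eqP.
apply: eq_big => [s|s _]; first by rewrite subcube0.
rewrite big_ord_recl /= -mulr_sumr mulNr indic_pred -transcript_iter; congr (_ - _ * _).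
by apply: eq_bigr => i _; rewrite indic_pred -transcript_iter.
Qed.

Lemma sum_asking_at_le_integral n :
  ((\sum_(i < n) fine (P (asking_at i)))%:E
    <= \int[P]_w num_queries A (U w) (S w) R)%E.
Proof.
have := integral_sum_indic P (index_enum 'I_n) (fun=> 1) asking_at
  (fun i => measurable_asking_at i).
under [in RHS]eq_bigr do rewrite mul1r.
move=> <-; apply: ge0_le_integral_nonmeas => w.
  by rewrite lee_fin sumr_ge0// => i _; rewrite mul1r.
apply: le_trans (sum_asking_le_num_queries A (U w) R (S w) n).
rewrite lee_fin; apply: ler_sum => i _.
by rewrite mul1r indic_pred.
Qed.

Lemma expected_num_queries_ge : (0 < M)%N ->
  ((((1 - Pe) * M%:R - 1) / 2)%:E
     <= \int[P]_w num_queries A (U w) (S w) R)%E.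
Proof.
move=> M0; have HI := sum_asking_at_le_integral.
set I := (\int[P]_w _)%E in HI *.
have I0 : (0 <= I)%E by have := HI 0%N; rewrite big_ord0.
(* Only a finite expectation [r] needs an argument. *)
case: I I0 HI => [r| |] //= _ HI; last by rewrite leey.
have M0' : (0 : R) < M%:R by rewrite ltr0n.
have H n : (P (guessed_by n) <= ((1 + 2 * r) / M%:R)%:E)%E.
  rewrite -[P _]fineK ?fin_num_measure ?lee_fin//; last exact: measurable_guessed_by.
  rewrite ler_pdivlMr// mulrC.
  by have := guessed_by_asking_at_le n; have := HI n; rewrite lee_fin; lra.
(* The bound [H] is uniform in [n], and the increasing events [guessed_by n] exhaust the success
   event, so it passes to the limit. *)
have : ((1 - Pe)%:E <= ((1 + 2 * r) / M%:R)%:E)%E.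
  apply: le_trans (guess_success hyp) _; rewrite outputs_bigcup.
  have nd : {homo guessed_by : m n / (m <= n)%N >-> (m <= n)%O}.
    move=> m n mn; apply/subsetPset => w /guessedP Hm; apply/guessedP.
    exact: stops_withW Hm.
  have cv := nondecreasing_cvg_mu (mu := P) measurable_guessed_by
    (bigcupT_measurable _ measurable_guessed_by) nd.
  rewrite -(cvg_lim _ cv)//; apply: lime_le; last by apply: nearW => n; exact: H.
  by apply/cvg_ex; eexists; exact: cv.
rewrite !lee_fin ler_pdivlMr//; lra.
Qed.

Lemma num_queries_linear_ge : (0 < M)%N ->
  ((1 - Pe - (8 / 9) ^+ M)%:E
    <= P [set w | ((4^-1 * M%:R)%:E <= num_queries A (U w) (S w) R)%E])%E.
Proof.
move=> M0; set G := [set w | _].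
have GE : G = \bigcap_(i in [set i | (i * 4 < M)%N]) asking_at i.
  have lt4 i : (i%:R < 4^-1 * M%:R :> R) = (i * 4 < M)%N.
    by rewrite mulrC ltr_pdivlMr// -natrM ltr_nat.
  apply/seteqP; split => [w /le_num_queriesP H i /= iM|w H].
    by apply: H; rewrite lt4.
  by apply/le_num_queriesP => i; rewrite lt4 => iM; exact: H.
have mG : measurable G.
  rewrite GE; apply: bigcap_measurable; first by exists 0%N.
  by move=> k _; exact: measurable_asking_at.
pose n := (M %/ 4)%N.
(* Outside [G] the run stops at some [i] with [i * 4 < M], hence [i <= n]; its output there agrees
   with the correct one, since both persist to time [maxn i m]. *)
have sub : [set w | outputs A (U w) (S w) (S w)] `<=` G `|` guessed_by n.
  move=> w [m Hm]; have [Gw|Gw] := pselect (G w); [by left|right].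
  move: Gw; rewrite GE => /existsNP[i /not_implyP[/= iM /negP/askingPn[y Hi]]].
  apply/guessedP; apply: (@stops_withW _ _ _ _ _ i); first by rewrite /n; lia.
  move: (stops_withW A (U w) (S w) _ _ _ (leq_maxl i m) Hi).
  by rewrite /stops_with (stops_withW A (U w) (S w) _ _ _ (leq_maxr i m) Hm) Hi.
have n0 : (P (guessed_by n) <= ((8 / 9) ^+ M)%:E)%E.
  rewrite -[P _]fineK ?fin_num_measure ?lee_fin//; last exact: measurable_guessed_by.
  apply: le_trans (guessed_by_le n) _.
  have -> : (8 / 9 : R) = (4 / 3) * (2 / 3) by field.
  rewrite [leRHS]exprMn ler_wpM2r//.
  (* Here [(4 / 3) ^+ 4 = 256 / 81] exceeds 3, and [4 * n <= M]. *)
  apply: (@le_trans _ _ ((4 / 3) ^+ (4 * n))).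
    by rewrite exprM; apply: lerXn2r; rewrite ?nnegrE; lra.
  by apply: ler_weXn2l; [lra|rewrite /n; lia].
rewrite EFinB leeBlDr//.
apply: le_trans (guess_success hyp) _.
apply: (@le_trans _ _ (P (G `|` guessed_by n))).
  apply: le_measure sub; rewrite inE.
    by rewrite outputs_bigcup; apply: bigcupT_measurable; exact: measurable_guessed_by.
  by apply: measurableU => //; exact: measurable_guessed_by.
apply: le_trans (measureU2 _ _ _) _ => //; first exact: measurable_guessed_by.
exact: leeD2l.
Qed.

End Bounds.

Theorem mainTheorem2 (R : realType) :
  (forall (M : nat) (d : measure_display) (Omega : measurableType d)
      (P : probability Omega R) (d' : measure_display) (W : measurableType d')
      (S : Omega -> M.-tuple bool) (U : Omega -> W) (A : algorithm M W) (Pe : R),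
    (0 < M)%N -> 0 <= Pe <= 1 ->
    guesses_string P S U A Pe ->
    ((((1 - Pe) * M%:R - 1) / 2)%:E
       <= \int[P]_w num_queries A (U w) (S w) R)%E)
  /\
  (exists (c : R) (eps : nat -> R),
    [/\ 0 < c, eps @ \oo --> (0 : R) &
      forall (M : nat) (d : measure_display) (Omega : measurableType d)
        (P : probability Omega R) (d' : measure_display) (W : measurableType d')
        (S : Omega -> M.-tuple bool) (U : Omega -> W) (A : algorithm M W) (Pe : R),
      (0 < M)%N -> 0 <= Pe <= 1 ->
      guesses_string P S U A Pe ->
      ((1 - Pe - eps M)%:E
         <= P [set w | ((c * M%:R)%:E <= num_queries A (U w) (S w) R)%E])%E]).
Proof.
split=> [M d Omega P d' W S U A Pe M0 _ hyp|].
  exact: expected_num_queries_ge hyp M0.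
exists 4^-1, (fun M => (8 / 9) ^+ M); split; first by rewrite invr_gt0.
  by apply: cvg_expr; rewrite ger0_norm; lra.
move=> M d Omega P d' W S U A Pe M0 _ hyp.
exact: num_queries_linear_ge hyp M0.
Qed.
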